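(* Consider a binary integer program $\Pi:\ \min_{x\in\mathcal X}f(x)$ with $\mathcal X\subseteq\{0,1\}^n$ and $f:\{0,1\}^n\to\mathbb R$, and let $\Omega:=\{T_x\mid x\in\mathcal X\}\subseteq\mathscr P([n])$. Consider the problems (Upper-inner) $\Pi_{ui}:\ \min_{x\in\{0,1\}^n} f(x)$ s.t. $\sum_{i\in T}x_i\ge 1$ for all $T\in m(\widehat{\overline\Omega})$; (Upper-outer) $\Pi_{uo}:\ \min_{x\in\{0,1\}^n} f(x)$ s.t. $\sum_{i\in T}x_i\ge 1$ for all $T\in m(\widehat{\overline{\uparrow\Omega}})$; (Lower-inner) $\Pi_{li}:\ \min_{x\in\{0,1\}^n} f(x)$ s.t. $\sum_{i\in T}x_i\le |T|-1$ for all $T\in m(\overline\Omega)$; (Lower-outer) $\Pi_{lo}:\ \min_{x\in\{0,1\}^n} f(x)$ s.t. $\sum_{i\in T}x_i\le |T|-1$ for all $T\in m(\overline{\downarrow\Omega})$. Then $\Pi_{ui}$ and $\Pi_{li}$ are inner approximations of $\Pi$ (their feasible sets are contained in $\mathcal X$), $\Pi_{uo}$ and $\Pi_{lo}$ are outer approximations of $\Pi$ (their feasible sets contain $\mathcal X$), and the optimal values satisfy $$z(\Pi_{uo})\le z(\Pi)\le z(\Pi_{ui}),\qquad z(\Pi_{lo})\le z(\Pi)\le z(\Pi_{li}).$$ Moreover, $\Pi_{ui}$ and $\Pi_{uo}$ are both equivalent to $\Pi$ (i.e. both have feasible set exactly $\mathcal X$) if and only if $\Omega$ is upper-closed; and $\Pi_{li}$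 and $\Pi_{lo}$ are both equivalent to $\Pi$ (i.e. both have feasible set exactly $\mathcal X$) if and only if $\Omega$ is lower-closed.
   Context: For $x\in\{0,1\}^n$, $T_x:=\{i\in[n]\mid x_i=1\}$. $\Delta:=[n]$, and a set system is a subset of the power set $\mathscr P(\Delta)$. A set system $\Omega$ is upper-closed if $T\in\Omega$ and $T\subseteq T'\subseteq\Delta$ imply $T'\in\Omega$; it is lower-closed if $T\in\Omega$ and $T'\subseteq T$ imply $T'\in\Omega$. Operators: $\uparrow\Omega:=\{T\subseteq\Delta\mid T\supseteq T'\text{ for some }T'\in\Omega\}$; $\downarrow\Omega:=\{T\subseteq\Delta\mid T\subseteq T'\text{ for some }T'\in\Omega\}$; $m(\Omega)$ is the family of inclusion-minimal members of $\Omega$; $\overline\Omega:=\mathscr P(\Delta)\setminus\Omega$; $\widehat\Omega:=\{\Delta\setminus T\mid T\in\Omega\}$. $z(\Pi)\in\mathbb R\cup\{\pm\infty\}$ denotes the optimal value of an optimization problem $\Pi$, with the value $+\infty$ for an infeasible minimization problem. Empty sums are $0$. *)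

(* Defs.v *)
From mathcomp Require Import all_boot all_order all_algebra.
From mathcomp Require Import constructive_ereal reals.

Set Implicit Arguments.
Unset Strict Implicit.
Unset Printing Implicit Defensive.

Import Order.TTheory GRing.Theory Num.Theory.

Local Open Scope ring_scope.

(* Set systems are of type {set {set 'I_n}}. The ground set is [set: 'I_n], so
   the complement of a system Omega in the power set is ~: Omega. *)

Definition upper_closed n (Omega : {set {set 'I_n}}) : Prop :=
  forall T T' : {set 'I_n}, T \in Omega -> T \subset T' -> T' \in Omega.

Definition lower_closed n (Omega : {set {set 'I_n}}) : Prop :=
  forall T T' : {set 'I_n}, T \in Omega -> T' \subset T -> T' \in Omega.

Definition upset n (Omega : {set {set 'I_n}}) : {set {set 'I_n}} :=
  [set T : {set 'I_n} | [exists T' in Omega, T' \subset T]].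

Definition downset n (Omega : {set {set 'I_n}}) : {set {set 'I_n}} :=
  [set T : {set 'I_n} | [exists T' in Omega, T \subset T']].

Definition minimals n (Omega : {set {set 'I_n}}) : {set {set 'I_n}} :=
  [set T : {set 'I_n} | minset (fun S => S \in Omega) T].

Definition hat n (Omega : {set {set 'I_n}}) : {set {set 'I_n}} :=
  [set ~: T | T in Omega].

(* The hypercube {0,1}^n; true is 1 and false is 0, through the coercion from
   bool to nat. *)
Definition cube n := {ffun 'I_n -> bool}.

Definition support_set n (x : cube n) : {set 'I_n} := [set i | x i].

Record binprog (R : realType) (n : nat) := BinProg {
  feasible : {set cube n};
  objective : cube n -> R }.

Definition set_system (R : realType) n (P : binprog R n) : {set {set 'I_n}} :=
  [set support_set x | x in feasible P].

(* There are finitely many feasible points, so the minimum is attained unless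
   there are none, in which case the value is +oo. *)
Definition optval (R : realType) n (P : binprog R n) : \bar R :=
  \big[Order.min/+oo%E]_(x in feasible P) (objective P x)%:E.

Definition cover_feasible n (C : {set {set 'I_n}}) : {set cube n} :=
  [set x : cube n | [forall T in C, 1 <= \sum_(i in T) (x i)%:Z]].

(* The inequality is over int: the empty set may belong to C, and its
   constraint 0 <= -1 must be unsatisfiable. *)
Definition pack_feasible n (C : {set {set 'I_n}}) : {set cube n} :=
  [set x : cube n | [forall T in C, \sum_(i in T) (x i)%:Z <= #|T|%:Z - 1]].

Definition upper_inner (R : realType) n (P : binprog R n) : binprog R n :=
  BinProg (cover_feasible (minimals (hat (~: set_system P)))) (objective P).

Definition upper_outer (R : realType) n (P : binprog R n) : binprog R n :=
  BinProg (cover_feasible (minimals (hat (~: upset (set_system P)))))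
          (objective P).

Definition lower_inner (R : realType) n (P : binprog R n) : binprog R n :=
  BinProg (pack_feasible (minimals (~: set_system P))) (objective P).

Definition lower_outer (R : realType) n (P : binprog R n) : binprog R n :=
  BinProg (pack_feasible (minimals (~: downset (set_system P))))
          (objective P).

(* Main.v *)
Require Import Defs.
From mathcomp Require Import all_boot all_order all_algebra.
From mathcomp Require Import constructive_ereal reals.

(** Write [T_x] for the support of [x]. A covering constraint indexed by
    [~: S] says that [T_x] is not contained in [S]; a packing constraint
    indexed by [S] says that [S] is not contained in [T_x]. Both conditions are
    inherited by supersets of the index set, so imposing them on the minimal
    members of a system imposes them on the whole system. Taking the
    contrapositive over all [S] outside a system [Omega],
    - the covering program built from [Omega] accepts [x] iff every superset of
      [T_x] belongs to [Omega] ([cover_feasibleP]);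
    - the packing program built from [Omega] accepts [x] iff every subset of
      [T_x] belongs to [Omega] ([pack_feasibleP]).

    Everything follows from these two descriptions. The inner programs are
    built from the set system of the original program, and [T_x] is a superset
    and a subset of itself, so they accept feasible points only. The outer
    programs are built from a system that is closed in the relevant direction,
    hence accept exactly the points whose support lies in that closure, which
    contains the original system. Inclusions of feasible sets give the
    inequalities between optimal values. Finally, a closed system equals its
    own closure, so both approximations are exact; conversely, exactness of the
    inner one says that all supersets (resp. subsets) of feasible supports
    are feasible supports, which is closedness. *)

Set Implicit Arguments.
Unset Strict Implicit.
Unset Printing Implicit Defensive.

Import Order.TTheory GRing.Theory Num.Theory.

Local Open Scope ring_scope.

Section SetSystems.

Variable n : nat.
Implicit Types (Omega C : {set {set 'I_n}}) (S T : {set 'I_n}) (x : cube n).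

Lemma support_set_inj : injective (@support_set n).
Proof.
by move=> x y /setP eq_xy; apply/ffunP => i; have := eq_xy i; rewrite !inE.
Qed.

Lemma support_set_surj T : exists x, support_set x = T.
Proof. by exists [ffun i => i \in T]; apply/setP => i; rewrite inE ffunE. Qed.

Lemma sum_support_set x T :
  \sum_(i in T) (x i)%:Z = #|T :&: support_set x|%:Z.
Proof.
rewrite -sum1_card (big_morph Posz PoszD (erefl 0)).
under [RHS]eq_bigl do rewrite !inE.
by rewrite big_mkcondr; apply: eq_bigr => i _; case: (x i).
Qed.

Lemma cover_constraintE x T :
  (1 <= \sum_(i in T) (x i)%:Z) = ~~ (support_set x \subset ~: T).
Proof.
by rewrite sum_support_set lez_nat card_gt0 setI_eq0 disjoint_sym disjoints_subset.
Qed.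

(** The sum is the size of [T :&: support_set x]; it reaches [#|T|] only when
    the intersection is all of [T]. For empty [T] both sides are false. *)
Lemma pack_constraintE x T :
  (\sum_(i in T) (x i)%:Z <= #|T|%:Z - 1) = ~~ (T \subset support_set x).
Proof.
rewrite sum_support_set lerBrDr -PoszD lez_nat addn1 ltnNge; congr (~~ _).
apply/idP/setIidPl => [leT|->//].
by apply/eqP; rewrite eqEcard subsetIl.
Qed.

(** A finite system has a minimal member below each of its members, so a
    condition that passes to supersets is decided on the minimal members. *)
Lemma forall_minimals C (Q : pred {set 'I_n}) :
    (forall S T, S \subset T -> Q S -> Q T) ->
  (forall T, T \in minimals C -> Q T) <-> (forall T, T \in C -> Q T).
Proof.
move=> Qup; split=> QC T.
  case/minset_exists => S minS sST; apply: (Qup S) => //.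
  by apply: QC; rewrite inE.
by rewrite inE => /minsetp; apply: QC.
Qed.

Lemma hat_setC Omega S : (~: S \in hat (~: Omega)) = (S \notin Omega).
Proof. by rewrite mem_imset ?inE //; apply: setC_inj. Qed.

(** The constraint indexed by [~: S], with [S] outside [Omega], forbids exactly
    the points whose support lies in [S]. *)
Lemma cover_feasibleP Omega x :
  x \in cover_feasible (minimals (hat (~: Omega))) <->
  (forall S, support_set x \subset S -> S \in Omega).
Proof.
have Qup S T : S \subset T -> ~~ (support_set x \subset ~: S) ->
    ~~ (support_set x \subset ~: T).
  by move=> sST; apply: contra => /subset_trans; apply; rewrite setCS.
have [toall tomin] := forall_minimals (hat (~: Omega)) Qup.
rewrite inE; split.
  move=> /forall_inP xC S; apply: contraTT; rewrite -hat_setC => hS.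
  rewrite -[S]setCK; apply: toall hS => T mT.
  by rewrite -cover_constraintE; apply: xC.
move=> xOm; apply/forall_inP => T mT; rewrite cover_constraintE.
apply: tomin mT => {}T; rewrite -[T]setCK hat_setC; apply: contra.
by rewrite setCK; apply: xOm.
Qed.

(** The constraint indexed by [S] outside [Omega] forbids exactly the points
    whose support contains [S]. *)
Lemma pack_feasibleP Omega x :
  x \in pack_feasible (minimals (~: Omega)) <->
  (forall S, S \subset support_set x -> S \in Omega).
Proof.
have Qup S T : S \subset T -> ~~ (S \subset support_set x) ->
    ~~ (T \subset support_set x).
  by move=> sST; apply: contra; apply: subset_trans.
have [toall tomin] := forall_minimals (~: Omega) Qup.
rewrite inE; split.
  move=> /forall_inP xC S; apply: contraTT; rewrite -in_setC.
  by apply: toall => T mT; rewrite -pack_constraintE; apply: xC.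
move=> xOm; apply/forall_inP => T mT; rewrite pack_constraintE.
by apply: tomin mT => {}T; rewrite inE; apply: contra; apply: xOm.
Qed.

Lemma cover_feasible_closed Omega x : upper_closed Omega ->
  (x \in cover_feasible (minimals (hat (~: Omega)))) =
  (support_set x \in Omega).
Proof.
move=> upOm; apply/idP/idP => [/cover_feasibleP|xOm]; first exact.
by apply/cover_feasibleP => S; apply: upOm.
Qed.

Lemma pack_feasible_closed Omega x : lower_closed Omega ->
  (x \in pack_feasible (minimals (~: Omega))) = (support_set x \in Omega).
Proof.
move=> loOm; apply/idP/idP => [/pack_feasibleP|xOm]; first exact.
by apply/pack_feasibleP => S; apply: loOm.
Qed.

Lemma upset_closed Omega : upper_closed (upset Omega).
Proof.
move=> S T; rewrite !inE => /exists_inP[U UOm sUS] sST.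
by apply/exists_inP; exists U => //; apply: subset_trans sST.
Qed.

Lemma downset_closed Omega : lower_closed (downset Omega).
Proof.
move=> S T; rewrite !inE => /exists_inP[U UOm sSU] sTS.
by apply/exists_inP; exists U => //; apply: subset_trans sSU.
Qed.

Lemma sub_upset Omega : Omega \subset upset Omega.
Proof. by apply/subsetP => T TOm; rewrite inE; apply/exists_inP; exists T. Qed.

Lemma sub_downset Omega : Omega \subset downset Omega.
Proof. by apply/subsetP => T TOm; rewrite inE; apply/exists_inP; exists T. Qed.

Lemma upset_id Omega : upper_closed Omega -> upset Omega = Omega.
Proof.
move=> upOm; apply/eqP; rewrite eqEsubset sub_upset andbT.
by apply/subsetP => T; rewrite inE => /exists_inP[S SOm]; apply: upOm.
Qed.

Lemma downset_id Omega : lower_closed Omega -> downset Omega = Omega.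
Proof.
move=> loOm; apply/eqP; rewrite eqEsubset sub_downset andbT.
by apply/subsetP => T; rewrite inE => /exists_inP[S SOm]; apply: loOm.
Qed.

End SetSystems.

Section Programs.

Variables (R : realType) (n : nat).
Implicit Types P Q : binprog R n.

Lemma support_set_system P x :
  (support_set x \in set_system P) = (x \in feasible P).
Proof. by rewrite mem_imset //; apply: support_set_inj. Qed.

Lemma optval_antitone P Q : objective P = objective Q ->
  feasible Q \subset feasible P -> (optval P <= optval Q)%E.
Proof.
rewrite /optval => -> /subsetP sQP.
exact: (@sub_bigmin _ (\bar R) +oo%E _ _ _ _ (fun x => (objective Q x)%:E) sQP).
Qed.

Lemma upper_inner_sub P : feasible (upper_inner P) \subset feasible P.
Proof.
apply/subsetP => x /cover_feasibleP xP.
by rewrite -support_set_system; apply: xP.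
Qed.

Lemma lower_inner_sub P : feasible (lower_inner P) \subset feasible P.
Proof.
apply/subsetP => x /pack_feasibleP xP.
by rewrite -support_set_system; apply: xP.
Qed.

Lemma sub_upper_outer P : feasible P \subset feasible (upper_outer P).
Proof.
apply/subsetP => x; rewrite -support_set_system => xP.
rewrite cover_feasible_closed; last exact: upset_closed.
exact: (subsetP (sub_upset _)).
Qed.

Lemma sub_lower_outer P : feasible P \subset feasible (lower_outer P).
Proof.
apply/subsetP => x; rewrite -support_set_system => xP.
rewrite pack_feasible_closed; last exact: downset_closed.
exact: (subsetP (sub_downset _)).
Qed.

(** Exactness of the inner program is what forces closedness: every set above
    the support of a feasible point must then belong to the system. In the
    other direction the system is its own up-set, so both programs coincide. *)
Lemma upper_exactP P :
  (feasible (upper_inner P) = feasible P /\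
   feasible (upper_outer P) = feasible P) <->
  upper_closed (set_system P).
Proof.
split=> [[innerE _] T S | upP].
  have [x <-] := support_set_surj T.
  by rewrite support_set_system -innerE => /cover_feasibleP; apply.
rewrite /= upset_id //.
by split; apply/setP => x; rewrite cover_feasible_closed ?support_set_system.
Qed.

(** Dual to [upper_exactP], with down-sets and the packing programs. *)
Lemma lower_exactP P :
  (feasible (lower_inner P) = feasible P /\
   feasible (lower_outer P) = feasible P) <->
  lower_closed (set_system P).
Proof.
split=> [[innerE _] T S | loP].
  have [x <-] := support_set_surj T.
  by rewrite support_set_system -innerE => /pack_feasibleP; apply.
rewrite /= downset_id //.
by split; apply/setP => x; rewrite pack_feasible_closed ?support_set_system.
Qed.

End Programs.

Theorem theorem2 (R : realType) (n : nat) (P : binprog R n) :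
  (feasible (upper_inner P) \subset feasible P) /\
  (feasible (lower_inner P) \subset feasible P) /\
  (feasible P \subset feasible (upper_outer P)) /\
  (feasible P \subset feasible (lower_outer P)) /\
  (optval (upper_outer P) <= optval P)%E /\
  (optval P <= optval (upper_inner P))%E /\
  (optval (lower_outer P) <= optval P)%E /\
  (optval P <= optval (lower_inner P))%E /\
  ((feasible (upper_inner P) = feasible P /\
    feasible (upper_outer P) = feasible P) <->
   upper_closed (set_system P)) /\
  ((feasible (lower_inner P) = feasible P /\
    feasible (lower_outer P) = feasible P) <->
   lower_closed (set_system P)).
Proof.
have ui := upper_inner_sub P; have li := lower_inner_sub P.
have uo := sub_upper_outer P; have lo := sub_lower_outer P.
have ue := upper_exactP P; have le := lower_exactP P.
by rewrite !optval_antitone //; do !split => //; tauto.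
Qed.
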